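(* Let $\bar{x}\in \mathbb{R}^J$ and $(\bar{y},\bar{w})\in \mathbb{R}^{M}\times \mathbb{R}^{I\times J}$ be such that $(\bar{y},\bar{w})$ satisfies the stationarity condition $\sum_{i\in I}\nabla F^i(\bar{w}^i)^T \bar{y}^i= c$. Then $$c\cdot \bar{x}+\sum_{i\in I} g_i\left(F^i\left(\bar{x}\right)\right)\;\geq\; -\sum_{i \in I} \mathcal{O}_{F^i,g_i}(-\bar{y}^i, \bar{w}^i).$$ In particular, if $\bar{x}$ is primal feasible and $(\bar{y},\bar{w})$ is dual feasible, then $\operatorname{obj_P}(\bar{x})\geq \operatorname{obj_D}(\bar{y},\bar{w})$.
   Context: Setting. $I$ and $J$ are finite sets, $c\in\mathbb{R}^J$, and for each $i\in I$, $M_i$ is a finite set, $F^i:\mathbb{R}^J\to\mathbb{R}^{M_i}$ and $g_i:\mathbb{R}^{M_i}\to\mathbb{R}\cup\{+\infty\}$. Write $\mathbb{R}^M:=\prod_{i\in I}\mathbb{R}^{M_i}$, so $y\in\mathbb{R}^M$ has blocks $y^i\in\mathbb{R}^{M_i}$, and $w\in\mathbb{R}^{I\times J}$ has blocks $w^i\in\mathbb{R}^J$. Standing assumptions, for each $i\in I$: (i) there is $\bar{x}^i\in\mathbb{R}^J$ with $g_i(F^i(\bar{x}^i))<+\infty$; (ii) $F^i$ is continuously differentiable; (iii) $g_i$ is a proper, closed (lower semicontinuous) and convex function; (iv) $(x,u)\mapsto g_i(F^i(x)+u)$ is jointly convex in $(x,u)\in\mathbb{R}^J\times\mathbb{R}^{M_i}$.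 Notation. $\nabla F^i(x)\in\mathbb{R}^{M_i\times J}$ is the Jacobian of $F^i$ at $x$; $g_i^*(v):=\sup_{z\in\mathbb{R}^{M_i}}\{v\cdot z-g_i(z)\}$ is the convex conjugate; $F^i_\nabla(y^i,w^i):=(\nabla F^i(w^i)w^i-F^i(w^i))\cdot y^i$; $\mathcal{O}_{F^i,g_i}(y^i,w^i):=F^i_\nabla(y^i,w^i)+g_i^*(y^i)$. For an extended-real-valued function $h:\mathbb{R}^L\to\mathbb{R}\cup\{+\infty\}$, $h^0$ is the identically zero function if the range of $h$ is contained in $\{0,+\infty\}$, and $h^0:=h$ otherwise. $\mathcal{O}^0_{F^i,g_i}(y^i,w^i):=F^i_\nabla(y^i,w^i)+(g_i^* )^0(y^i)$. Primal problem: $\inf_{x\in\mathbb{R}^J} c\cdot x+\sum_{i\in I}g_i(F^i(x))$. Dual problem: $\sup_{y\in\mathbb{R}^M,\,w\in\mathbb{R}^{I\times J}}\; -\sum_{i\in I}\mathcal{O}_{F^i,g_i}(-y^i,w^i)$ subject to $\sum_{i\in I}\nabla F^i(w^i)^Ty^i=c$. Feasibility. $\bar{x}\in\mathbb{R}^J$ is primal feasible if $g_i(F^i(\bar{x}))<+\infty$ for all $i\in I$. $(\bar{y},\bar{w})$ is dual feasible if $g_i^*(-\bar{y}^i)<+\infty$ for all $i\in I$ and $\sum_{i\in I}\nabla F^i(\bar{w}^i)^T\bar{y}^i=c$. Objective values: $\operatorname{obj_P}(\bar{x}):=c\cdot\bar{x}+\sum_{i\in I}g_i^0(F^i(\bar{x}))$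 and $\operatorname{obj_D}(\bar{y},\bar{w}):=-\sum_{i\in I}\mathcal{O}^0_{F^i,g_i}(-\bar{y}^i,\bar{w}^i)$. *)

(* Defs.v *)
From HB Require Import structures.
From mathcomp Require Import all_boot all_order all_algebra.
From mathcomp Require Import all_classical all_reals all_analysis.

Set Implicit Arguments.
Unset Strict Implicit.
Unset Printing Implicit Defensive.

Import Order.TTheory GRing.Theory Num.Theory.
Import numFieldNormedType.Exports.

Local Open Scope classical_set_scope.
Local Open Scope ring_scope.

(* Points of R^L, for L finite with n elements, are row vectors 'rV[R]_n.
   The library's Jacobian 'J f x acts on row vectors from the right
   ('d f x v = v *m 'J f x), hence it is the transpose of the usual
   matrix \nabla f(x): the vector \nabla f(x) v reads v *m 'J f x and
   \nabla f(x)^T y reads y *m ('J f x)^T.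

   R \cup {+oo} is rendered by \bar R together with the condition that the
   value -oo is not taken, which is part of [eproper]. *)

Definition dot (R : realType) n (u v : 'rV[R]_n) : R :=
  \sum_(j < n) u 0 j * v 0 j.

Definition continuously_differentiable (R : realType) n m
    (f : 'rV[R]_n -> 'rV[R]_m) : Prop :=
  (forall x, differentiable f x) /\
  continuous (fun x : 'rV[R]_n => 'J f x : 'M[R]_(n, m)).

Definition eproper (R : realType) (E : Type) (h : E -> \bar R) : Prop :=
  (forall z, h z != -oo%E) /\ (exists z, (h z < +oo)%E).

(* At the endpoints t = 0, 1 the convention 0 * (+oo) = 0 makes the
   inequality an equality. *)
Definition econvex (R : realType) (E : lmodType R) (h : E -> \bar R) : Prop :=
  forall (x y : E) (t : R), 0 <= t <= 1 ->
    (h (t *: x + (1 - t) *: y)%R <= t%:E * h x + (1 - t)%:E * h y)%E.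

Definition conjugate (R : realType) n (h : 'rV[R]_n -> \bar R)
    (v : 'rV[R]_n) : \bar R :=
  ereal_sup [set ((dot v z)%:E - h z)%E | z in [set: 'rV[R]_n]].

(* h^0 *)
Definition zeroed (R : realType) (E : Type) (h : E -> \bar R) : E -> \bar R :=
  if `[< range h `<=` [set 0%E; +oo%E] >] then (fun=> 0%E) else h.

(* F_\nabla(y, w) = (\nabla F(w) w - F(w)) . y *)
Definition Fnabla (R : realType) n m (F : 'rV[R]_n -> 'rV[R]_m)
    (y : 'rV[R]_m) (w : 'rV[R]_n) : R :=
  dot (w *m 'J F w - F w) y.

Definition Ocal (R : realType) n m (F : 'rV[R]_n -> 'rV[R]_m)
    (g : 'rV[R]_m -> \bar R) (y : 'rV[R]_m) (w : 'rV[R]_n) : \bar R :=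
  ((Fnabla F y w)%:E + conjugate g y)%E.

Definition Ocal0 (R : realType) n m (F : 'rV[R]_n -> 'rV[R]_m)
    (g : 'rV[R]_m -> \bar R) (y : 'rV[R]_m) (w : 'rV[R]_n) : \bar R :=
  ((Fnabla F y w)%:E + zeroed (conjugate g) y)%E.

Section problem.
Variables (R : realType) (I : finType) (n : nat) (m : I -> nat).
Variables (c : 'rV[R]_n) (F : forall i, 'rV[R]_n -> 'rV[R]_(m i)).
Variable (g : forall i, 'rV[R]_(m i) -> \bar R).
Implicit Types (x : 'rV[R]_n) (y : forall i, 'rV[R]_(m i)) (w : I -> 'rV[R]_n).

Definition stationary y w : Prop :=
  \sum_(i : I) y i *m ('J (F i) (w i))^T = c.

Definition primal_feasible x : Prop :=
  forall i, (g (F i x) < +oo)%E.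

Definition dual_feasible y w : Prop :=
  (forall i, (conjugate (@g i) (- y i)%R < +oo)%E) /\ stationary y w.

Definition obj_P x : \bar R :=
  ((dot c x)%:E + \sum_(i : I) zeroed (@g i) (F i x))%E.

Definition obj_D y w : \bar R :=
  (- \sum_(i : I) Ocal0 (F i) (@g i) (- y i)%R (w i))%E.

End problem.

(* Main.v *)
Require Import Defs.
From mathcomp Require Import all_boot all_order all_algebra.
From mathcomp Require Import all_classical all_reals all_analysis.
From mathcomp Require Import ring lra.
Import Order.TTheory GRing.Theory Num.Theory.
Import numFieldNormedType.Exports.
Local Open Scope classical_set_scope.
Local Open Scope ring_scope.

Set Implicit Arguments.
Unset Strict Implicit.
Unset Printing Implicit Defensive.

(** Everything happens for one index i at a time. Fix one pair (F, g) and a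
    multiplier v. If conjugate g v is finite, then v . F is a convex function,
    although F itself has no convexity of its own. Indeed, let
      d = F (t x1 + (1 - t) x2) - (t F x1 + (1 - t) F x2)
    be the convexity gap of F. Joint convexity of (x, u) |-> g (F x + u),
    used at the points (xk, z - F xk), which both have value g z, says that
    g (z + d) <= g z for every z in the domain of g
    ([convexity_gap_recession]). Hence g stays bounded along the half-line
    z + k d, and a linear form v with a finite conjugate cannot increase
    along it: v . d <= 0 ([recession_dot_le0]), which is convexity of v . F
    ([conjugate_dom_convex]).

    A differentiable convex function lies above its tangents
    ([convex_tangent_le]), so linearizing F at w in the Fenchel-Young
    inequality g (F x) + conjugate g v >= v . F x only decreases the right
    side. This gives
      g (F x) + Ocal F g v w >= v . (x *m 'J F w)
    ([linearized_fenchel_young]), an inequality that holds trivially when the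
    conjugate is infinite. Adding these up with v = - y i, the stationarity
    condition turns the right sides into - c . x, which is weak duality.

    For feasible points, replacing a function by its zeroed version does not
    change any term ([zeroed_dom]), so the second claim is an instance of the
    first. *)

(** * The scalar product *)

Section DotProduct.
Variables (R : realType) (n : nat).
Implicit Types u v w : 'rV[R]_n.

Lemma dotC u v : dot u v = dot v u.
Proof. by apply: eq_bigr => j _; rewrite mulrC. Qed.

Lemma dotDr u v w : dot u (v + w) = dot u v + dot u w.
Proof.
by rewrite /dot -big_split; apply: eq_bigr => j _; rewrite !mxE mulrDr.
Qed.

Lemma dotZr a u v : dot u (a *: v) = a * dot u v.
Proof.
by rewrite /dot mulr_sumr; apply: eq_bigr => j _; rewrite !mxE mulrCA.
Qed.

Lemma dotNr u v : dot u (- v) = - dot u v.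
Proof. by rewrite -scaleN1r dotZr mulN1r. Qed.

Lemma dotBr u v w : dot u (v - w) = dot u v - dot u w.
Proof. by rewrite dotDr dotNr. Qed.

Lemma dotNl u v : dot (- u) v = - dot u v.
Proof. by rewrite dotC dotNr dotC. Qed.

Lemma dot_suml (I : finType) (u : I -> 'rV[R]_n) v :
  dot (\sum_i u i) v = \sum_i dot (u i) v.
Proof.
rewrite /dot exchange_big; apply: eq_bigr => j _.
by rewrite summxE mulr_suml.
Qed.

Lemma dot_continuous u : continuous (dot u).
Proof.
have term_continuous j : continuous (fun v : 'rV[R]_n => u 0 j * v 0 j).
  move=> v; apply: cvgMl_tmp; first exact: nbhs_filter.
  exact: coord_continuous.
apply: continuous_big => [|j _]; first exact: add_continuous.
exact: term_continuous.
Qed.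

End DotProduct.

Lemma dot_mulmx_tr (R : realType) m n (y : 'rV[R]_m) (A : 'M[R]_(n, m))
    (x : 'rV[R]_n) : dot (y *m A^T) x = dot y (x *m A).
Proof.
have dotE k (a b : 'rV[R]_k) : dot a b = (a *m b^T) 0 0.
  by rewrite mxE; apply: eq_bigr => j _; rewrite mxE.
by rewrite !dotE trmx_mul mulmxA.
Qed.

(** * Tangents of a convex function *)

(** The difference quotients of v . F at w in the direction x - w are at most
    v . F x - v . F w for steps in ]0, 1], by convexity on the segment from w
    to x; the directional derivative is their limit from the right. *)
Lemma convex_tangent_le (R : realType) n m (F : 'rV[R]_n -> 'rV[R]_m)
    (v : 'rV[R]_m) (w x : 'rV[R]_n) : differentiable F w ->
  (forall t, 0 <= t <= 1 ->
    dot v (F (t *: x + (1 - t) *: w)) <=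
    t * dot v (F x) + (1 - t) * dot v (F w)) ->
  dot v ((x - w) *m 'J F w) <= dot v (F x) - dot v (F w).
Proof.
move=> dF cvxF.
have quotient_cvg : dot v (h^-1 *: (F (h *: (x - w) + w) - F w)) @[h --> 0^'+]
    --> dot v ((x - w) *m 'J F w).
  apply: cvg_dnbhs_at_right; apply: continuous_cvg; first exact: dot_continuous.
  rewrite /jacobian mul_rV_lin1 -deriveE //.
  by have := @diff_derivable _ _ _ F w (x - w) dF.
rewrite -(cvg_lim _ quotient_cvg) //; apply: limr_le.
  by apply/cvg_ex; exists (dot v ((x - w) *m 'J F w)).
near=> h; have h_gt0 : 0 < h by near: h; exact: nbhs_right_gt.
have h_le1 : h <= 1 by near: h; exact: nbhs_right_le.
rewrite dotZr dotBr mulrC ler_pdivrMr //.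
have -> : h *: (x - w) + w = h *: x + (1 - h) *: w.
  by rewrite scalerBr scalerBl scale1r addrAC addrA.
have := cvxF h; rewrite (ltW h_gt0) h_le1 => /(_ isT); lra.
Unshelve. all: by end_near.
Qed.

(** * Conjugates and recession directions *)

Section Conjugate.
Variables (R : realType) (m : nat) (g : 'rV[R]_m -> \bar R).
Implicit Types v z d : 'rV[R]_m.

Lemma fenchel_young v z : ((dot v z)%:E - g z <= conjugate g v)%E.
Proof. by apply: ereal_sup_ubound; exists z. Qed.

Lemma conjugate_neqNy v : eproper g -> conjugate g v != -oo%E.
Proof.
move=> [gNy [z gz]]; have := fenchel_young v z; have := gNy z.
by case: (g z) gz => // r _ _; case: (conjugate g v).
Qed.

(** Iterating the hypothesis from one point z of the domain gives
    g (z + k d) <= g z for all k, so that v . (z + k d) - g z, which is affine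
    in k with slope v . d, is bounded above by conjugate g v. *)
Lemma recession_dot_le0 v d : eproper g -> (conjugate g v < +oo)%E ->
  (forall z, (g z < +oo)%E -> (g (z + d) <= g z)%E) -> dot v d <= 0.
Proof.
move=> [gNy [z gz]] gv gd.
have gzk k : (g (z + k%:R *: d) <= g z)%E.
  elim: k => [|k IHk]; first by rewrite scale0r addr0.
  rewrite -natr1 scalerDl scale1r addrA; apply: le_trans (IHk).
  by apply: gd; exact: le_lt_trans IHk gz.
have {}gzk k : ((dot v z + k%:R * dot v d)%:E <= conjugate g v + g z)%E.
  have := le_trans (leeB (lexx (dot v (z + k%:R *: d))%:E) (gzk k))
    (fenchel_young v (z + k%:R *: d)).
  rewrite dotDr dotZr; have := gNy z; case: (g z) gz => // r _ _.
  by rewrite leeBlDr.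
move: gzk gv; have := gNy z; case: (g z) gz => // r _ _.
case: (conjugate g v) => // [s|] gzk _; last by have := gzk 0.
have {}gzk k : k%:R * dot v d <= s + r - dot v z.
  by rewrite lerBrDl -lee_fin.
rewrite leNgt; apply/negP => vd_gt0.
have [b_ge0|b_lt0] := leP 0 ((s + r - dot v z) / dot v d).
  by have := archi_boundP b_ge0; rewrite ltr_pdivrMr // ltNge gzk.
move: b_lt0; rewrite ltr_pdivrMr // mul0r ltNge.
by have := gzk 0; rewrite mul0r => ->.
Qed.

End Conjugate.

(** * The composite function *)

Section Composite.
Variables (R : realType) (n m : nat).
Variables (F : 'rV[R]_n -> 'rV[R]_m) (g : 'rV[R]_m -> \bar R).
Hypothesis g_proper : eproper g.
Hypothesis gF_convex :
  econvex (fun p : 'rV[R]_n * 'rV[R]_m => g (F p.1 + p.2)).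

(** The two points (x1, z - F x1) and (x2, z - F x2) both have the value g z,
    and the value at their convex combination is g of z plus the convexity
    gap of F. *)
Lemma convexity_gap_recession (x1 x2 : 'rV[R]_n) (t : R) z : 0 <= t <= 1 ->
  (g z < +oo)%E ->
  (g (z + (F (t *: x1 + (1 - t) *: x2)%R -
           (t *: F x1 + (1 - t) *: F x2)))%R <= g z)%E.
Proof.
move=> t01 gz.
have := gF_convex (x1, z - F x1) (x2, z - F x2) t01 => /=.
rewrite !subrKC => gFt.
have -> : z + (F (t *: x1 + (1 - t) *: x2) - (t *: F x1 + (1 - t) *: F x2)) =
    F (t *: x1 + (1 - t) *: x2) +
    (t *: (z - F x1) + (1 - t) *: (z - F x2)).
  by apply/rowP => j; rewrite !mxE; ring.
apply: le_trans gFt _; have := g_proper.1 z; case: (g z) gz => // r _ _.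
by rewrite -!EFinM -EFinD lee_fin -mulrDl subrKC mul1r.
Qed.

Lemma conjugate_dom_convex v : (conjugate g v < +oo)%E ->
  forall (x1 x2 : 'rV[R]_n) (t : R), 0 <= t <= 1 ->
    dot v (F (t *: x1 + (1 - t) *: x2)) <=
    t * dot v (F x1) + (1 - t) * dot v (F x2).
Proof.
move=> gv x1 x2 t t01; rewrite -!dotZr -dotDr -subr_le0 -dotBr.
by apply: recession_dot_le0 gv _ => // z; exact: convexity_gap_recession.
Qed.

(** Fenchel-Young at F x with F replaced by its linearization at w: the
    constant part of the linearization is what Fnabla adds to the
    conjugate. *)
Lemma linearized_fenchel_young v (w x : 'rV[R]_n) : differentiable F w ->
  ((dot v (x *m 'J F w))%:E <= g (F x) + Ocal F g v w)%E.
Proof.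
move=> dF; rewrite /Ocal.
have := @conjugate_neqNy _ _ g v g_proper; have := g_proper.1 (F x).
have := @fenchel_young _ _ g v (F x); have := @conjugate_dom_convex v.
(* If either extended value is +oo, so is the right side: neither is -oo. *)
case: (conjugate g v) => [s|//|//]; last first.
  by case: (g (F x)) => [r|_ _ _ _|//]; rewrite ?leey.
case: (g (F x)) => [r cvx fy _ _|//|//]; last by rewrite leey.
have tangent := convex_tangent_le dF (cvx (ltry _) x w).
move: fy; rewrite -EFinB lee_fin => fy.
rewrite -!EFinD lee_fin /Fnabla (dotC _ v) dotBr.
move: tangent; rewrite mulmxBl dotBr; lra.
Qed.

End Composite.

(** * Weak duality *)

(** A function with values in {0, +oo} vanishes wherever it is finite. *)
Lemma zeroed_dom (R : realType) (E : Type) (h : E -> \bar R) z :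
  (h z < +oo)%E -> zeroed h z = h z.
Proof.
rewrite /zeroed; case: ifPn => // /asboolP h0 hz.
by have [->|hzy] := h0 (h z) (ex_intro2 _ _ z I erefl); last by rewrite hzy in hz.
Qed.

Theorem theorem1 (R : realType) (I : finType) (n : nat) (m : I -> nat)
    (c : 'rV[R]_n)
    (F : forall i : I, 'rV[R]_n -> 'rV[R]_(m i))
    (g : forall i : I, 'rV[R]_(m i) -> \bar R)
    (g_dom : forall i, exists x : 'rV[R]_n, (g i (F i x) < +oo)%E)
    (F_C1 : forall i, continuously_differentiable (F i))
    (g_proper : forall i, eproper (g i))
    (g_closed : forall i, lower_semicontinuous (g i))
    (g_convex : forall i, econvex (g i))
    (gF_convex : forall i,
      econvex (fun p : 'rV[R]_n * 'rV[R]_(m i) => g i (F i p.1 + p.2)%R))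
    (x : 'rV[R]_n) (y : forall i : I, 'rV[R]_(m i)) (w : I -> 'rV[R]_n)
    (yw_stationary : stationary c F y w) :
  ((dot c x)%:E + \sum_(i : I) g i (F i x) >=
     - \sum_(i : I) Ocal (F i) (g i) (- y i)%R (w i))%E
  /\ (primal_feasible F g x -> dual_feasible c F g y w ->
      (obj_P c F g x >= obj_D F g y w)%E).
Proof.
have weak_duality : (- \sum_(i : I) Ocal (F i) (g i) (- y i)%R (w i) <=
    (dot c x)%:E + \sum_(i : I) g i (F i x))%E.
  have : ((- dot c x)%:E <= \sum_(i : I) g i (F i x) +
      \sum_(i : I) Ocal (F i) (g i) (- y i)%R (w i))%E.
    rewrite -big_split -[c]yw_stationary dot_suml -sumrN -sumEFin /=.
    apply: lee_sum => i _; rewrite dot_mulmx_tr -dotNl.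
    exact: (linearized_fenchel_young (g_proper i) (gF_convex i) _ _ ((F_C1 i).1 _)).
  (* The real lower bound excludes that one sum is -oo: in \bar R the value
     -oo absorbs +oo under addition. *)
  case: (\sum_(i : I) g i (F i x))%E => [r||];
    case: (\sum_(i : I) Ocal _ _ _ _)%E => [s||] //=; rewrite ?leey ?leNye //.
  by rewrite -!EFinD !lee_fin; lra.
split=> // x_feas [y_feas _]; rewrite /obj_P /obj_D /Ocal0.
under [X in (_ + X)%E]eq_bigr do rewrite zeroed_dom //.
by under [X in (- X)%E]eq_bigr do rewrite zeroed_dom //.
Qed.
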